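(* Let $$R=\begin{bmatrix}1&-\mathbf j&-q\mathbf j&-\mathbf j&1&-1&-1\\-1&1&-\mathbf j&-q\mathbf j&-\mathbf j&1&-1\\-1&-1&1&-\mathbf j&-q\mathbf j&-\mathbf j&1\\1&-1&-1&1&-\mathbf j&-q\mathbf j&-\mathbf j\\-\mathbf j&1&-1&-1&1&-\mathbf j&-q\mathbf j\\-q\mathbf j&-\mathbf j&1&-1&-1&1&-\mathbf j\\-\mathbf j&-q\mathbf j&-\mathbf j&1&-1&-1&1\end{bmatrix}$$ and $$S=\begin{bmatrix}1&1&1&1&1&1&1\\1&-\mathbf kq\mathbf j&-\mathbf kq\mathbf k&\mathbf kq&\mathbf kq\mathbf k&\mathbf kq\mathbf j&(\mathbf kq)^2\\1&-q^*\mathbf i&\mathbf i&-\mathbf k&\mathbf k&-\mathbf i&\mathbf iq\\1&-1&\mathbf jq^*\mathbf j&\mathbf k&-\mathbf j&-\mathbf k&q\\1&\mathbf i&-1&-\mathbf iq^*\mathbf j&-\mathbf k&\mathbf k&\mathbf kq\\1&-\mathbf j&\mathbf j&-1&-\mathbf iq^*\mathbf i&\mathbf i&-q\\1&-\mathbf i&-\mathbf j&\mathbf i&-1&\mathbf jq^*\mathbf k&-\mathbf iq\end{bmatrix}.$$ Neither the quaternionic Hadamard matrix $R$ nor the quaternionic Hadamard matrix $S$ is equivalent to the order seven complex Fourier matrix $F_7$.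
   Context: $\mathbb H$ is the real algebra of quaternions with basic units $\mathbf i,\mathbf j,\mathbf k$ ($\mathbf i\mathbf j=\mathbf k=-\mathbf j\mathbf i$, squares equal to $-1$), $x\mapsto x^*$ is quaternion conjugation, and $q=(1+\mathbf i+\mathbf j+\mathbf k)/2$. Complex numbers are viewed inside $\mathbb H$ as $\mathrm{span}_{\mathbb R}\{1,\mathbf i\}$. The order $n$ complex Fourier matrix is $F_n=(\omega^{rs})_{0\le r,s<n}$ with $\omega=\exp(2\pi\mathbf i/n)$. A quaternionic Hadamard matrix (QHM) of order $n$ is an $n\times n$ matrix $G$ with unit-norm quaternion entries such that $GG^*=nI_n$, where $G^*$ is the conjugate transpose. Two QHMs are equivalent if one can be obtained from the other by multiplying rows on the left by unit quaternions, multiplying columns on the right by unit quaternions, interchanging rows, or interchanging columns. *)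

(* Defs.v *)
From HB Require Import structures.
From mathcomp Require Import all_boot all_order all_algebra.
From mathcomp Require Import reals sequences exp trigo.
From mathcomp Require Import complex.
From mathcomp Require Import ring.

Set Implicit Arguments.
Unset Strict Implicit.
Unset Printing Implicit Defensive.

Import Order.TTheory GRing.Theory Num.Theory.
Local Open Scope ring_scope.
Local Open Scope complex_scope.

(* Quat a b c d is the quaternion a + b i + c j + d k. *)
Record quat (K : Type) := Quat { qre : K; qim_i : K; qim_j : K; qim_k : K }.

Section QuatChoice.
Variable K : choiceType.

Definition quat_to_prod (x : quat K) : K * K * K * K :=
  (qre x, qim_i x, qim_j x, qim_k x).
Definition prod_to_quat (t : K * K * K * K) : quat K :=
  let: (a, b, c, d) := t in Quat a b c d.
Fact quat_to_prodK : cancel quat_to_prod prod_to_quat.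
Proof. by case. Qed.

HB.instance Definition _ := Choice.copy (quat K) (can_type quat_to_prodK).
End QuatChoice.

Section QuatAlgebra.
Variable K : realType.
Implicit Types x y z : quat K.

Definition qadd x y :=
  Quat (qre x + qre y) (qim_i x + qim_i y) (qim_j x + qim_j y)
       (qim_k x + qim_k y).
Definition qopp x := Quat (- qre x) (- qim_i x) (- qim_j x) (- qim_k x).
Definition qzero : quat K := Quat 0 0 0 0.

Fact qaddA : associative qadd.
Proof. by case=> ? ? ? ? [? ? ? ?] [? ? ? ?]; congr Quat; rewrite /= addrA. Qed.
Fact qaddC : commutative qadd.
Proof. by case=> ? ? ? ? [? ? ? ?]; congr Quat; rewrite /= addrC. Qed.
Fact qadd0 : left_id qzero qadd.
Proof. by case=> ? ? ? ?; congr Quat; rewrite /= add0r. Qed.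
Fact qaddN : left_inverse qzero qopp qadd.
Proof. by case=> ? ? ? ?; congr Quat; rewrite /= addNr. Qed.

HB.instance Definition _ :=
  GRing.isZmodule.Build (quat K) qaddA qaddC qadd0 qaddN.

Definition qone : quat K := Quat 1 0 0 0.
Definition qmul x y :=
  let: Quat a b c d := x in
  let: Quat a' b' c' d' := y in
  Quat (a * a' - b * b' - c * c' - d * d')
       (a * b' + b * a' + c * d' - d * c')
       (a * c' - b * d' + c * a' + d * b')
       (a * d' + b * c' - c * b' + d * a').

Fact qmulA : associative qmul.
Proof. by case=> ? ? ? ? [? ? ? ?] [? ? ? ?]; congr Quat; ring. Qed.
Fact qmul1 : left_id qone qmul.
Proof. by case=> ? ? ? ?; congr Quat; ring. Qed.
Fact qmulr1 : right_id qone qmul.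
Proof. by case=> ? ? ? ?; congr Quat; ring. Qed.
Fact qmulDl : left_distributive qmul +%R.
Proof. by case=> ? ? ? ? [? ? ? ?] [? ? ? ?]; congr Quat; rewrite /=; ring. Qed.
Fact qmulDr : right_distributive qmul +%R.
Proof. by case=> ? ? ? ? [? ? ? ?] [? ? ? ?]; congr Quat; rewrite /=; ring. Qed.
Fact qone_neq0 : qone != 0.
Proof. by apply/eqP => -[] /eqP; rewrite oner_eq0. Qed.

HB.instance Definition _ := GRing.Zmodule_isNzRing.Build (quat K)
  qmulA qmul1 qmulr1 qmulDl qmulDr qone_neq0.

Definition qscale (a : K) x :=
  Quat (a * qre x) (a * qim_i x) (a * qim_j x) (a * qim_k x).

Fact qscaleA a b x : qscale a (qscale b x) = qscale (a * b) x.
Proof. by congr Quat; rewrite /= mulrA. Qed.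
Fact qscale1 : left_id 1 qscale.
Proof. by case=> ? ? ? ?; congr Quat; rewrite /= mul1r. Qed.
Fact qscaleDr : right_distributive qscale +%R.
Proof. by move=> a x y; congr Quat; rewrite /= mulrDr. Qed.
Fact qscaleDl x : {morph qscale^~ x : a b / a + b}.
Proof. by move=> a b; congr Quat; rewrite /= mulrDl. Qed.

HB.instance Definition _ := GRing.Zmodule_isLmodule.Build K (quat K)
  qscaleA qscale1 qscaleDr qscaleDl.

Fact qscaleAl (a : K) x y : a *: (x * y) = (a *: x) * y.
Proof. by case: x => ????; case: y => ????; congr Quat; rewrite /=; ring. Qed.
HB.instance Definition _ :=
  GRing.Lmodule_isLalgebra.Build K (quat K) qscaleAl.

Fact qscaleAr (a : K) x y : a *: (x * y) = x * (a *: y).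
Proof. by case: x => ????; case: y => ????; congr Quat; rewrite /=; ring. Qed.
HB.instance Definition _ :=
  GRing.Lalgebra_isAlgebra.Build K (quat K) qscaleAr.

Definition qi : quat K := Quat 0 1 0 0.
Definition qj : quat K := Quat 0 0 1 0.
Definition qk : quat K := Quat 0 0 0 1.

Definition qconj x := Quat (qre x) (- qim_i x) (- qim_j x) (- qim_k x).

Definition qnorm x : K :=
  Num.sqrt (qre x ^+ 2 + qim_i x ^+ 2 + qim_j x ^+ 2 + qim_k x ^+ 2).

Definition quat_of_complex (z : K[i]) : quat K :=
  let: a +i* b := z in Quat a b 0 0.

Definition cexp (z : K[i]) : K[i] :=
  let: a +i* b := z in (expR a)%:C * (cos b +i* sin b).

Definition omega (n : nat) : K[i] := cexp (0 +i* (2 * pi / n%:R)).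

Definition fourier (n : nat) : 'M[K[i]]_n := \matrix_(r, s) omega n ^+ (r * s).

Definition fourierH (n : nat) : 'M[quat K]_n :=
  map_mx quat_of_complex (fourier n).

Local Close Scope complex_scope.

Definition qadjoint n (G : 'M[quat K]_n) : 'M[quat K]_n := map_mx qconj G^T.

Definition is_QHM n (G : 'M[quat K]_n) : Prop :=
  (forall r s, qnorm (G r s) = 1) /\ G *m qadjoint G = n%:R%:M.

Definition scale_row n (r0 : 'I_n) (u : quat K) (G : 'M[quat K]_n) :=
  \matrix_(r, s) (if r == r0 then u * G r s else G r s).

Definition scale_col n (s0 : 'I_n) (u : quat K) (G : 'M[quat K]_n) :=
  \matrix_(r, s) (if s == s0 then G r s * u else G r s).

Inductive yields n (G : 'M[quat K]_n) : 'M[quat K]_n -> Prop :=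
| Yields_refl : yields G G
| Yields_scale_row H r u :
    yields G H -> qnorm u = 1 -> yields G (scale_row r u H)
| Yields_scale_col H s u :
    yields G H -> qnorm u = 1 -> yields G (scale_col s u H)
| Yields_xrow H r1 r2 :
    yields G H -> yields G (xrow r1 r2 H)
| Yields_xcol H s1 s2 :
    yields G H -> yields G (xcol s1 s2 H).

Definition qhm_equiv n (G H : 'M[quat K]_n) : Prop :=
  yields G H \/ yields H G.

Definition mx_of_rows n (rows : seq (seq (quat K))) : 'M[quat K]_n :=
  \matrix_(r, s) nth 0 (nth [::] rows r) s.

Definition q : quat K := 2^-1 *: (1 + qi + qj + qk).

Definition Rmx : 'M[quat K]_7 :=
  let j := qj in
  mx_of_rows 7
  [:: [:: 1; - j; - (q * j); - j; 1; - 1; - 1];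
      [:: - 1; 1; - j; - (q * j); - j; 1; - 1];
      [:: - 1; - 1; 1; - j; - (q * j); - j; 1];
      [:: 1; - 1; - 1; 1; - j; - (q * j); - j];
      [:: - j; 1; - 1; - 1; 1; - j; - (q * j)];
      [:: - (q * j); - j; 1; - 1; - 1; 1; - j];
      [:: - j; - (q * j); - j; 1; - 1; - 1; 1]].

Definition Smx : 'M[quat K]_7 :=
  let i := qi in let j := qj in let k := qk in let q' := qconj q in
  mx_of_rows 7
  [:: [:: 1; 1; 1; 1; 1; 1; 1];
      [:: 1; - (k * q * j); - (k * q * k); k * q; k * q * k; k * q * j; (k * q) ^+ 2];
      [:: 1; - (q' * i); i; - k; k; - i; i * q];
      [:: 1; - 1; j * q' * j; k; - j; - k; q];
      [:: 1; i; - 1; - (i * q' * j); - k; k; k * q];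
      [:: 1; - j; j; - 1; - (i * q' * i); i; - q];
      [:: 1; - i; - j; i; - 1; j * q' * k; - (i * q)]].

End QuatAlgebra.

(* Main.v *)
(** For rows [r, t] and columns [s, p] the cross ratio
    [g_rs g_ts^* g_tp g_rp^*] of a matrix with unit entries changes under
    equivalence operations only by conjugation by a unit quaternion and by
    relabelling of rows and columns, so the condition that its [n]-th power is
    always [1] is invariant. It holds for the order [n] Fourier matrix, whose
    entries are [n]-th roots of unity, whereas both [R] and [S] have a cross
    ratio equal to [-1], and [(-1)^7 <> 1]. *)

Require Import Defs.
From mathcomp Require Import all_boot all_order all_algebra reals.
From mathcomp Require Import perm sequences exp trigo complex ring.

Set Implicit Arguments.
Unset Strict Implicit.
Unset Printing Implicit Defensive.

Import Order.TTheory GRing.Theory Num.Theory.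
Local Open Scope ring_scope.

Section Quaternions.
Variable K : realType.
Implicit Types (x y u : quat K) (n : nat).

Lemma qconjM x y : qconj (x * y) = qconj y * qconj x.
Proof. by case: x => ????; case: y => ????; congr Quat; rewrite /=; ring. Qed.

Lemma qconj1 : qconj 1 = 1 :> quat K.
Proof. by congr Quat; rewrite /= oppr0. Qed.

Lemma qconjX x n : qconj (x ^+ n) = qconj x ^+ n.
Proof. by elim: n => [|n IHn]; rewrite ?qconj1 // exprS qconjM IHn -exprSr. Qed.

Lemma qconj_comm x : GRing.comm x (qconj x).
Proof. by case: x => ????; congr Quat; rewrite /=; ring. Qed.

(** Removes the square root from the norm: unit norm becomes a polynomial identity, usable for
    cancellation and checkable by [field]. *)
Lemma qnorm1P u : qnorm u = 1 <-> u * qconj u = 1.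
Proof.
pose N := qre u ^+ 2 + qim_i u ^+ 2 + qim_j u ^+ 2 + qim_k u ^+ 2.
have N0 : 0 <= N by rewrite !addr_ge0 ?sqr_ge0.
have uu : u * qconj u = Quat N 0 0 0.
  by rewrite /N {N N0}; case: u => ????; congr Quat; rewrite /=; ring.
rewrite uu /qnorm -/N; split=> [N1|[->]]; last exact: sqrtr1.
by rewrite -[N]sqr_sqrtr// N1 expr1n.
Qed.

Lemma qnorm1_mulconj u : qnorm u = 1 -> u * qconj u = 1.
Proof. exact: (qnorm1P u).1. Qed.

Lemma qnorm_one : qnorm (1 : quat K) = 1.
Proof. by rewrite /qnorm /= expr1n expr0n !addr0 sqrtr1. Qed.

Lemma qconj_mulVK u : qnorm u = 1 -> qconj u * u = 1.
Proof. by rewrite -qconj_comm; exact: qnorm1_mulconj. Qed.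

Lemma conj_expr1 u x n :
  qnorm u = 1 -> (u * x * qconj u) ^+ n = 1 <-> x ^+ n = 1.
Proof.
move=> u1; have -> : (u * x * qconj u) ^+ n = u * x ^+ n * qconj u.
  elim: n => [|n IHn]; first by rewrite mulr1 qnorm1_mulconj.
  by rewrite !exprS IHn -!mulrA (mulrA (qconj u)) qconj_mulVK// mul1r !mulrA.
split=> [E|->]; last by rewrite mulr1 qnorm1_mulconj.
have -> : x ^+ n = qconj u * (u * x ^+ n * qconj u) * u.
  by rewrite !mulrA qconj_mulVK// mul1r -mulrA qconj_mulVK// mulr1.
by rewrite E mulr1 qconj_mulVK.
Qed.

Lemma quat_of_complexM (z w : K[i]) :
  quat_of_complex (z * w) = quat_of_complex z * quat_of_complex w.
Proof. by case: z => a b; case: w => c d; congr Quat; rewrite /=; ring. Qed.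

Lemma quat_of_complexX (z : K[i]) n :
  quat_of_complex (z ^+ n) = quat_of_complex z ^+ n.
Proof. by elim: n => // n IHn; rewrite !exprS quat_of_complexM IHn. Qed.

(** De Moivre's formula, by the addition formulas for [cos] and [sin]. *)
Lemma cexpX (b : K) n :
  cexp (Complex 0 b) ^+ n = cexp (Complex 0 (b * n%:R)).
Proof.
elim: n => [|n IHn].
  by rewrite expr0 mulr0 /cexp expR0 cos0 sin0 mul1r.
rewrite exprS IHn mulrS mulrDr mulr1 /cexp expR0 !mul1r cosD sinD.
by congr Complex; rewrite addrC.
Qed.

Lemma omega_unity n : (0 < n)%N -> omega K n ^+ n = 1.
Proof.
move=> n0; rewrite cexpX divfK ?pnatr_eq0 -?lt0n// /cexp expR0 mul1r.
by rewrite mulrC mulr_natr cos2pi sin2pi.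
Qed.

Definition cross_ratio n (G : 'M[quat K]_n) r t s p :=
  G r s * qconj (G t s) * G t p * qconj (G r p).

Definition cross_ratios_unity m n (G : 'M[quat K]_n) :=
  forall r t s p, cross_ratio G r t s p ^+ m = 1.

(** Neighbouring factors of the cross ratio share in turn column [s], row [t] and column [p], so
    [v s], [u t] and [v p] meet their conjugates and cancel; only the outer [u r] survives. Whole
    families [u] and [v] let one lemma serve both kinds of scaling. *)
Lemma cross_ratios_unity_scale m n (G H : 'M[quat K]_n) (u v : 'I_n -> quat K) :
    (forall r, qnorm (u r) = 1) -> (forall s, qnorm (v s) = 1) ->
    (forall r s, H r s = u r * G r s * v s) ->
  cross_ratios_unity m H <-> cross_ratios_unity m G.
Proof.
move=> u1 v1 HE.
have E r t s p :
    cross_ratio H r t s p = u r * cross_ratio G r t s p * qconj (u r).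
  rewrite /cross_ratio !HE !qconjM !mulrA.
  rewrite -(mulrA _ (v s)) qnorm1_mulconj// mulr1.
  rewrite -(mulrA _ (qconj (u t))) qconj_mulVK// mulr1.
  by rewrite -(mulrA _ (v p)) qnorm1_mulconj// mulr1.
by split=> G1 r t s p; have := G1 r t s p; rewrite E conj_expr1.
Qed.

(** An equivalence rather than an implication, because [qhm_equiv] allows either matrix to be the
    starting one. *)
Lemma cross_ratios_unity_yields m n (G H : 'M[quat K]_n) :
  yields G H -> cross_ratios_unity m H <-> cross_ratios_unity m G.
Proof.
elim=> {H} [//|H r u _ <- u1|H s u _ <- u1|H a b _ <-|H a b _ <-].
- apply: (@cross_ratios_unity_scale m n H _ (fun i => if i == r then u else 1)
    (fun=> 1)) => [i|i|i l]; rewrite ?mxE.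
  + by case: ifP => // _; exact: qnorm_one.
  + exact: qnorm_one.
  + by case: ifP; rewrite mulr1 ?mul1r.
- apply: (@cross_ratios_unity_scale m n H _ (fun=> 1)
    (fun i => if i == s then u else 1)) => [i|i|i l]; rewrite ?mxE.
  + exact: qnorm_one.
  + by case: ifP => // _; exact: qnorm_one.
  + by case: ifP; rewrite mul1r ?mulr1.
- split=> H1 r t s p; last by rewrite /cross_ratio !mxE; exact: H1.
  (* A transposition is its own inverse, so evaluating at swapped indices undoes the exchange. *)
  have := H1 (tperm a b r) (tperm a b t) s p.
  by rewrite /cross_ratio !mxE !tpermK.
- split=> H1 r t s p; last by rewrite /cross_ratio !mxE; exact: H1.
  have := H1 r t (tperm a b s) (tperm a b p).
  by rewrite /cross_ratio !mxE !tpermK.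
Qed.

Lemma cross_ratios_unity_fourier n :
  (0 < n)%N -> cross_ratios_unity n (fourierH K n).
Proof.
move=> n0 r t s p; rewrite /cross_ratio !mxE !quat_of_complexX !qconjX.
set w := quat_of_complex _; set w' := qconj w.
have wn : w ^+ n = 1 by rewrite -quat_of_complexX omega_unity.
have w'n : w' ^+ n = 1 by rewrite -qconjX wn qconj1.
(* A quaternion commutes with its conjugate, so all four factors commute and the [n]-th power can be
   taken factor by factor. *)
have ww' a b : GRing.comm (w ^+ a) (w' ^+ b).
  by apply/commrX/commr_sym/commrX/commr_sym/qconj_comm.
have unity x a : x ^+ n = 1 -> (x ^+ a) ^+ n = 1.
  by move=> xn; rewrite exprAC xn expr1n.
rewrite !exprMn_comm ?unity ?mulr1//.
- apply/commr_sym/commrM; first by apply/commrX/commr_sym/commrX.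
  exact: ww'.
- apply/commr_sym/commrM; last by apply/commr_sym/ww'.
  apply/commrM; first exact/commr_sym/ww'.
  by apply/commrX/commr_sym/commrX.
Qed.

Lemma not_equiv_fourier n (G : 'M[quat K]_n) r t s p :
  (0 < n)%N -> cross_ratio G r t s p ^+ n <> 1 -> ~ qhm_equiv G (fourierH K n).
Proof.
move=> n0 Gn1 GF; apply: Gn1.
suff : cross_ratios_unity n G by exact.
have F1 := cross_ratios_unity_fourier n0.
by case: GF => /(cross_ratios_unity_yields n) [] /[swap]; auto.
Qed.

End Quaternions.

Lemma quat_eq (T : Type) (x y : quat T) :
    qre x = qre y -> qim_i x = qim_i y -> qim_j x = qim_j y ->
  qim_k x = qim_k y -> x = y.
Proof. by case: x => ????; case: y => ???? /= -> -> -> ->. Qed.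

Ltac quat_field := apply: quat_eq; rewrite /=; field.

Ltac case_ord7 i := case: i => -[|[|[|[|[|[|[|//]]]]]]] ?.

Lemma is_QHM_Rmx (K : realType) : is_QHM (Rmx K).
Proof.
split=> [r s|].
  by apply/qnorm1P; rewrite mxE; case_ord7 r; case_ord7 s; quat_field.
apply/matrixP => r s; rewrite !mxE !big_ord_recl big_ord0 !mxE.
by case_ord7 r; case_ord7 s; quat_field.
Qed.

(** Multiplies out the products in [q] once, so that later checks on [S] handle explicit coordinates
    only. *)
Lemma SmxE (K : realType) :
  let h := 2^-1 in
  Smx K = mx_of_rows 7
    [:: [:: 1; 1; 1; 1;
            1; 1; 1];
        [:: 1; Quat h h h h; Quat h (- h) (- h) h; Quat (- h) (- h) h h;
            Quat (- h) h h (- h); Quat (- h) (- h) (- h) (- h); Quat (- h) h (- h) (- h)];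
        [:: 1; Quat (- h) (- h) h (- h); qi K; - qk K;
            qk K; - qi K; Quat (- h) h (- h) h];
        [:: 1; - 1; Quat (- h) (- h) h (- h); qk K;
            - qj K; - qk K; Quat h h h h];
        [:: 1; qi K; - 1; Quat h (- h) (- h) (- h);
            - qk K; qk K; Quat (- h) (- h) h h];
        [:: 1; - qj K; qj K; - 1;
            Quat h (- h) h h; qi K; Quat (- h) (- h) (- h) (- h)];
        [:: 1; - qi K; - qj K; qi K;
            - 1; Quat (- h) h h h; Quat h (- h) h (- h)]].
Proof.
apply/matrixP => r s; rewrite !mxE.
by case_ord7 r; case_ord7 s; quat_field.
Qed.

Lemma is_QHM_Smx (K : realType) : is_QHM (Smx K).
Proof.
rewrite SmxE; split=> [r s|].
  by apply/qnorm1P; rewrite mxE; case_ord7 r; case_ord7 s; quat_field.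
apply/matrixP => r s; rewrite !mxE !big_ord_recl big_ord0 !mxE.
by case_ord7 r; case_ord7 s; quat_field.
Qed.

Lemma qopp1_expr7 (K : realType) : (-1 : quat K) ^+ 7 <> 1.
Proof.
by rewrite -signr_odd expr1 => /(congr1 (@qre K)) /= /eqP; rewrite eqNr oner_eq0.
Qed.

Theorem proposition24 (K : realType) :
  (is_QHM (Rmx K) /\ ~ qhm_equiv (Rmx K) (fourierH K 7)) /\
  (is_QHM (Smx K) /\ ~ qhm_equiv (Smx K) (fourierH K 7)).
Proof.
split; split.
- exact: is_QHM_Rmx.
(* The chosen entries of [R] are real: one is [1], the other three are [-1], so their product is
   [-1]. *)
- apply: (@not_equiv_fourier K 7 _ ord0 (inord 1) ord0 (inord 6)) => //.
  suff -> : cross_ratio (Rmx K) ord0 (inord 1) ord0 (inord 6) = -1.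
    exact: qopp1_expr7.
  by rewrite /cross_ratio !mxE !inordK//; quat_field.
- exact: is_QHM_Smx.
(* Row and column [0] of [S] consist of ones, so this cross ratio is just the entry [-1] in row [3],
   column [1]. *)
- apply: (@not_equiv_fourier K 7 _ (inord 3) ord0 (inord 1) ord0) => //.
  suff -> : cross_ratio (Smx K) (inord 3) ord0 (inord 1) ord0 = -1.
    exact: qopp1_expr7.
  by rewrite SmxE /cross_ratio !mxE !inordK//; quat_field.
Qed.
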